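(* For every integer $r \ge 1413$ with $r \equiv 0$ or $1 \pmod 3$ (that is, every admissible $r \ge 1413$ for $k=3$, $w=9$), there exists a $\mathrm{PENT}(3,r,9)$ of type D where each component of the deficiency graph has girth $4$.
   Context: A partial linear space is a (finite) set of points together with a set of lines, each line identified with the set of points incident with it, such that two distinct points lie on at most one common line. Two points are collinear if some line contains both (so a point that lies on a line is collinear with itself). A Steiner system $S(2,k,w)$ is a set of $w$ points with a collection of $k$-subsets (blocks) such that each pair of distinct points is contained in exactly one block. A generalized pentagonal geometry $\mathrm{PENT}(k,r,w)$ is a partial linear space in which every line has exactly $k$ points, every point is on exactly $r$ lines, and for every point $x$ the set of points not collinear with $x$ has size $w$ and is the point set of a Steiner system $S(2,k,w)$, denoted $x^{\mathrm{opp}}$, whose blocks are lines of the geometry. Its deficiency graph has the points of the geometry as vertices, with $x \sim y$ precisely when $x$ and $y$ are not collinear. Given $k$ and $w$, $r$ is admissible if $r(w+1-r) \equiv 0 \pmod k$. An opposite design pair in a $\mathrm{PENT}(k,r,w)$ is a pair of Steiner systems $S(2,k,w)$ with disjoint point sets, whose blocks are lines of the geometry, such that for each point $x$ of either system, $x^{\mathrm{opp}}$ is the other system. A generalized pentagonal geometry is of type D if its deficiency graph is not connected and has girth $4$, and the geometry does not contain an opposite design pair. *)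

(* Defs.v *)
From mathcomp Require Import all_boot.

Set Implicit Arguments.
Unset Strict Implicit.
Unset Printing Implicit Defensive.

(** * Simple graphs, given by an adjacency relation on a finite type *)

Section Graphs.
Variables (V : finType) (e : rel V).

Definition connected_graph : Prop := forall x y : V, connect e x y.

(* [e] is meant to be symmetric, so that [connect e] is an equivalence. *)
Definition components : {set {set V}} :=
  [set [set y | connect e x y] | x : V].

(* A cycle of the subgraph of [e] induced on [A]. The bound [2 < size c] is
   needed because [ucycle] accepts [::] and back-and-forth pairs [:: x; y]. *)
Definition is_cycle (A : {set V}) (c : seq V) : Prop :=
  [/\ 2 < size c, ucycle e c & {subset c <= A}].

(* The subgraph induced on [A] has (finite) girth [g]. *)
Definition has_girth (A : {set V}) (g : nat) : Prop :=
  (exists2 c, is_cycle A c & size c = g) /\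
  (forall c, is_cycle A c -> g <= size c).

End Graphs.

(** * Steiner systems and generalized pentagonal geometries *)

Record design (T : finType) := Design {
  dpoints : {set T};
  dblocks : {set {set T}} }.

Section Geometry.
Variable T : finType.

Definition steiner_system (k w : nat) (D : design T) : Prop :=
  [/\ #|dpoints D| = w,
      forall b, b \in dblocks D -> b \subset dpoints D /\ #|b| = k &
      forall x y, x \in dpoints D -> y \in dpoints D -> x != y ->
        exists! b, [/\ b \in dblocks D, x \in b & y \in b]].

(* A geometry has all of [T] as points; [lines] is its set of lines. *)
Variable lines : {set {set T}}.

Definition partial_linear_space : Prop :=
  forall x y, x != y ->
  forall l m, l \in lines -> m \in lines ->
    x \in l -> y \in l -> x \in m -> y \in m -> l = m.

Definition collinear : rel T :=
  [rel x y | [exists l in lines, (x \in l) && (y \in l)]].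

Definition deficiency : rel T := [rel x y | ~~ collinear x y].

(* [D] is the Steiner system x^opp. It is determined by [x] when [2 <= k]:
   its blocks are then all the lines contained in its point set. *)
Definition is_opp (k w : nat) (x : T) (D : design T) : Prop :=
  [/\ dpoints D = [set y | ~~ collinear x y],
      dblocks D \subset lines &
      steiner_system k w D].

Definition PENT (k r w : nat) : Prop :=
  [/\ partial_linear_space,
      forall l, l \in lines -> #|l| = k,
      forall x, #|[set l in lines | x \in l]| = r &
      forall x, exists D, is_opp k w x D].

Definition opposite_design_pair (k w : nat) (D1 D2 : design T) : Prop :=
  [/\ steiner_system k w D1 /\ steiner_system k w D2,
      dblocks D1 \subset lines /\ dblocks D2 \subset lines,
      [disjoint dpoints D1 & dpoints D2],
      forall x, x \in dpoints D1 -> is_opp k w x D2 &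
      forall x, x \in dpoints D2 -> is_opp k w x D1].

Definition type_D (k w : nat) : Prop :=
  [/\ ~ connected_graph deficiency,
      has_girth deficiency [set: T] 4 &
      ~ exists D1 D2, opposite_design_pair k w D1 D2].

End Geometry.

(* Main.v *)
Require Import Defs.
From mathcomp Require Import all_boot all_algebra zify ring.

Set Implicit Arguments.
Unset Strict Implicit.
Unset Printing Implicit Defensive.

(** Write a PENT(3, r, 9) on v = 2h points, where h = r + 5: a point lies on r
    lines, which account for 2r other points, and misses 9 points. The
    condition on r says that h is congruent to 0 or 2 modulo 3, so the claim
    is that every such h >= 1418 is attained.

    The geometry is encoded by its deficiency relation [e] and by the operation
    [f] giving the third point of the line through two collinear points
    ([pent_on]). Both requirements beyond PENT are local to a component of the
    deficiency graph. The graph has no triangle, since the points missed by x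
    are pairwise collinear, so girth 4 means that there is a 4-cycle
    ([pent_square]). An opposite design pair is a component K_{9,9}; it is
    excluded as soon as some two points missed by x do not miss the same
    points ([pent_twist]). Hence disjoint unions of deficiency graphs keep all
    the properties, and give a disconnected graph for free.

    Recursion. If a group divisible design with blocks of size 3 is given and
    each of its groups carries such a geometry, the blocks of the design
    together with the lines inside the groups form a new geometry ([glue]). Take
    a transversal design with four groups of size n, which exists for n odd
    (lines over the integers modulo n), delete all but t points of the last
    group, and double every point: a truncated block of size 3 is replaced by
    the 3-GDD of type 2^3 (a Latin square) and a block of size 4 by the 3-GDD
    of type 2^4 (the affine plane of order 3 without a point). The result is a
    3-GDD of type (2n)^3 (2t)^1, so that h = 3n + t is attained when n (odd) and
    t <= n are, t = 0 being allowed ([pent_step]).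

    Starting geometries. Thirteen values of h, from 15 to 129, are attained by
    geometries with a cyclic automorphism group acting semiregularly with 2 or
    4 orbits, given by representatives of their lines and verified by
    computation on orbit representatives ([cyclic_pent], [bases_ok]).

    Closure. A computation shows that the recursion attains from these every
    suitable h between 1418 and 4351 ([reached_middle]); above that, eight values
    of t suffice to go down from h to an odd n = (h - t) / 3 >= 1418
    ([split_pent_large]). *)

(** * Generalized pentagonal geometries as partial operations *)

Section PentOn.
Variables (P : finType) (A : {set P}) (e : rel P) (f : P -> P -> P).

(** The relation [e] is the deficiency relation and, for [~~ e x y], [f x y] is
    the third point of the line through [x] and [y]. Setting [f x x = x] makes
    [pent_line] say, for [x] and [y] distinct, that the three points are
    distinct and that each pair of them determines the same third point.
    Everything is relative to a subset [A] so that geometries on the groups of a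
    design can live in the ambient point type. *)
Record pent_on : Prop := PentOn {
  pent_sym : {in A &, symmetric e};
  pent_irr : {in A, irreflexive e};
  pent_stable : {in A &, forall x y, ~~ e x y -> f x y \in A};
  pent_idem : {in A, forall x, f x x = x};
  pent_comm : {in A &, forall x y, ~~ e x y -> f x y = f y x};
  pent_line : {in A &, forall x y, ~~ e x y ->
    ~~ e x (f x y) /\ f x (f x y) = y};
  pent_opp : {in A & &, forall x y z, e x y -> e x z ->
    ~~ e y z /\ e x (f y z)};
  pent_deg : {in A, forall x, #|[set y in A | e x y]| = 9};
  pent_square : {in A, forall x, exists y z u,
    [/\ y \in A, z \in A & u \in A] /\
    [/\ e x y, e x z, e u y, e u z & (y != z) && (u != x)]};
  pent_twist : {in A, forall x, exists y z u,
    [/\ y \in A, z \in A & u \in A] /\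
    [/\ e x y, e x z, e u y & ~~ e u z]} }.

(** A disconnected graph, witnessed by a nonconstant vertex colouring that is
    constant on components; unlike paths, it moves easily along bijections. *)
Definition separated : Prop := exists c : pred P,
  [/\ exists2 x, x \in A & c x, exists2 x, x \in A & ~~ c x &
      {in A &, forall x y, e x y -> c x = c y}].

End PentOn.

Lemma equicardinal_bij (P Q : finType) (A : {set P}) (B : {set Q}) x0 :
  x0 \in A -> #|A| = #|B| ->
  exists (a : P -> Q) (b : Q -> P),
    [/\ {in A, forall x, a x \in B}, {in B, forall y, b y \in A},
        {in A, cancel a b} & {in B, cancel b a}].
Proof.
move=> Ax0 cAB.
have [y0 By0] : exists y, y \in B.
  by apply/set0Pn; rewrite -card_gt0 -cAB card_gt0; apply/set0Pn; exists x0.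
have sz : size (enum A) = size (enum B) by rewrite -!cardE.
exists (fun x => nth y0 (enum B) (index x (enum A))).
exists (fun y => nth x0 (enum A) (index y (enum B))).
split=> [x Ax|y By|x Ax|y By].
- by rewrite -mem_enum mem_nth // -sz index_mem mem_enum.
- by rewrite -mem_enum mem_nth // sz index_mem mem_enum.
- rewrite index_uniq ?enum_uniq ?nth_index ?mem_enum //.
  by rewrite -sz index_mem mem_enum.
- rewrite index_uniq ?enum_uniq ?nth_index ?mem_enum //.
  by rewrite sz index_mem mem_enum.
Qed.

Lemma pent_transport (P Q : finType) (A : {set P}) (B : {set Q}) e f :
  #|A| = #|B| -> pent_on A e f ->
  exists e' f', pent_on B e' f' /\ (separated A e -> separated B e').
Proof.
move=> cAB pA.
have [A0|/set0Pn[x0 Ax0]] := eqVneq A set0.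
  have B0 : B = set0 by apply/eqP; rewrite -cards_eq0 -cAB A0 cards0.
  exists (fun _ _ => false), (fun x _ => x); split.
    by rewrite B0; split=> x; rewrite inE.
  by case=> c [[x]]; rewrite A0 inE.
have [a [b [aP bP ab ba]]] := equicardinal_bij Ax0 cAB.
exists (fun x y => e (b x) (b y)), (fun x y => a (f (b x) (b y))).
split; last first.
  case=> c [[x Ax cx] [y Ay cy] ce]; exists (fun y => c (b y)); split.
  - by exists (a x); [exact: aP | rewrite ab].
  - by exists (a y); [exact: aP | rewrite ab].
  - by move=> u v Bu Bv /ce-> //; exact: bP.
have st x y : x \in B -> y \in B -> ~~ e (b x) (b y) -> f (b x) (b y) \in A.
  by move=> Bx By; apply: (pent_stable pA); apply: bP.
split.
- by move=> x y Bx By; apply: (pent_sym pA); apply: bP.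
- by move=> x Bx; apply: (pent_irr pA); apply: bP.
- by move=> x y Bx By /st fA; apply/aP/fA.
- by move=> x Bx; rewrite (pent_idem pA) ?ba ?bP.
- by move=> x y Bx By nxy; rewrite (pent_comm pA) ?bP.
- move=> x y Bx By nxy; rewrite ab ?st //.
  by have [-> ->] := pent_line pA (bP _ Bx) (bP _ By) nxy; rewrite ba.
- move=> x y z Bx By Bz exy exz.
  have [nyz exf] := pent_opp pA (bP _ Bx) (bP _ By) (bP _ Bz) exy exz.
  by rewrite ab // st.
- move=> x Bx; rewrite -(pent_deg pA (bP _ Bx)).
  rewrite -[RHS](@card_in_imset _ _ a); last first.
    by move=> y z; rewrite !inE => /andP[Ay _] /andP[Az _] /(congr1 b); rewrite !ab.
  apply: eq_card => y; rewrite !inE; apply/andP/imsetP.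
    by case=> By exy; exists (b y); rewrite ?inE ?bP ?ba.
  by case=> z; rewrite inE => /andP[Az exz] ->; rewrite aP ?ab.
- move=> x Bx; have [y [z [u [[Ay Az Au] [exy exz euy euz /andP[nyz nux]]]]]] :=
    pent_square pA (bP _ Bx).
  exists (a y), (a z), (a u); rewrite !ab // !aP //; split=> //; split=> //.
  apply/andP; split; first by apply: contraNneq nyz => /(congr1 b); rewrite !ab // => ->.
  by apply: contraNneq nux => <-; rewrite ab.
- move=> x Bx; have [y [z [u [[Ay Az Au] [exy exz euy neuz]]]]] :=
    pent_twist pA (bP _ Bx).
  by exists (a y), (a z), (a u); rewrite !ab // !aP.
Qed.

Definition pent_size (v : nat) : Prop :=
  exists (P : finType) (A : {set P}) e f, #|A| = v /\ pent_on A e f.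

Definition split_pent_size (v : nat) : Prop :=
  exists (P : finType) (A : {set P}) e f,
    [/\ #|A| = v, pent_on A e f & separated A e].

Lemma split_pent_sizeW v : split_pent_size v -> pent_size v.
Proof. by case=> P [A [e [f [cA pA _]]]]; exists P, A, e, f. Qed.

(** The empty geometry stands for an empty group of a design. *)
Lemma pent_size0 : pent_size 0.
Proof.
exists unit, set0, (fun _ _ => false), (fun x _ => x).
by rewrite cards0; split=> //; split=> x; rewrite inE.
Qed.

Lemma pent_of_size (v : nat) (P : finType) (A : {set P}) :
  #|A| = v -> pent_size v -> exists e f, pent_on A e f.
Proof.
move=> cA [Q [B [e [f [cB pB]]]]].
have [|e' [f' [pA _]]] := pent_transport (B := A) _ pB; first by rewrite cA.
by exists e', f'.
Qed.

Section Glue.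
Variables (P : finType) (A : {set P}) (I : finType) (gr : P -> I).
Variable g : P -> P -> P.

(** A 3-GDD on [A] with groups the fibres of [gr]: [g] completes two points of
    distinct groups to a block. *)
Record gdd_on : Prop := GddOn {
  gdd_stable : {in A &, forall x y, gr x != gr y ->
    [/\ g x y \in A, gr (g x y) != gr x & gr (g x y) != gr y]};
  gdd_comm : {in A &, forall x y, gr x != gr y -> g x y = g y x};
  gdd_line : {in A &, forall x y, gr x != gr y -> g x (g x y) = y} }.

(** Two points of distinct groups are collinear through a block of the design,
    so the deficiency graph is the disjoint union of those of the groups; it is
    separated because two groups are nonempty. *)
Lemma glue :
  gdd_on ->
  (forall i, pent_size #|[set x in A | gr x == i]|) ->
  {in A &, forall x y, gr x != gr y -> split_pent_size #|A|}.
Proof.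
move=> gA sz x1 y1 Ax1 Ay1 n1.
have /(@fin_all_exists _ _ _ )[E EP] : forall i, exists e, exists f,
    pent_on [set x in A | gr x == i] e f.
  by move=> i; apply: (pent_of_size (erefl _)); apply: sz.
have /fin_all_exists[F pEF] := EP.
pose e x y := (gr x == gr y) && E (gr x) x y.
pose f x y := if gr x == gr y then F (gr x) x y else g x y.
have inG x : x \in A -> x \in [set y in A | gr y == gr x] by move=> Ax; rewrite inE Ax /=.
have inG2 x y : y \in A -> gr y = gr x -> y \in [set y in A | gr y == gr x].
  by move=> Ax /eqP; rewrite inE Ax => ->.
have up i x : x \in [set y in A | gr y == i] -> x \in A /\ gr x = i.
  by rewrite inE => /andP[-> /eqP].
exists P, A, e, f; split=> //; last first.
  exists (fun x => gr x == gr x1); split.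
  - by exists x1.
  - by exists y1 => //; rewrite eq_sym.
  - by move=> x y _ _ /andP[/eqP->].
have fst x y : x \in A -> y \in A -> gr x = gr y -> ~~ E (gr x) x y ->
    F (gr x) x y \in A /\ gr (F (gr x) x y) = gr x.
  move=> Ax Ay gxy nE; apply: up.
  by apply: (pent_stable (pEF _)) => //; [exact: inG | exact: inG2].
split.
- move=> x y Ax Ay; rewrite /e eq_sym; case: eqP => //= gxy.
  by rewrite gxy (pent_sym (pEF _)) ?inG ?inG2.
- by move=> x Ax; rewrite /e (pent_irr (pEF _)) ?inG ?andbF.
- move=> x y Ax Ay; rewrite /e /f; case: eqP => /= [gxy /(fst _ _ Ax Ay gxy)[]//|/eqP gxy _].
  by case: (gdd_stable gA Ax Ay gxy).
- by move=> x Ax; rewrite /f eqxx (pent_idem (pEF _)) ?inG.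
- move=> x y Ax Ay; rewrite /e /f eq_sym; case: eqP => /= [gxy|/eqP gxy _].
    by rewrite gxy => nE; rewrite (pent_comm (pEF _)) ?inG ?inG2.
  by rewrite eq_sym in gxy; rewrite (gdd_comm gA).
- move=> x y Ax Ay; rewrite /e /f; case: (gr x =P gr y) => /= [gxy nE|/eqP gxy _].
    have [Af gf] := fst _ _ Ax Ay gxy nE; rewrite gf eqxx /=.
    by apply: (pent_line (pEF _)) => //; rewrite ?inG ?inG2.
  have [Ag gx gy] := gdd_stable gA Ax Ay gxy.
  by rewrite eq_sym (negbTE gx) /= (gdd_line gA).
- move=> x y z Ax Ay Az /andP[/eqP gxy exy] /andP[/eqP gxz exz].
  have [nyz exf] := pent_opp (pEF _) (inG x Ax) (inG2 x y Ay (esym gxy))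
    (inG2 x z Az (esym gxz)) exy exz.
  have gyz : gr y = gr z by rewrite -gxy.
  have [|Af gf] := fst _ _ Ay Az gyz; first by rewrite -gxy.
  by rewrite /e /f -gyz eqxx gf -gxy eqxx /= nyz.
- move=> x Ax; rewrite -(pent_deg (pEF _) (inG x Ax)).
  by apply: eq_card => y; rewrite !inE /e eq_sym andbA.
- move=> x Ax.
  have [y [z [u [[/up[Ay gy] /up[Az gz] /up[Au gu]] [exy exz euy euz H]]]]] :=
    pent_square (pEF _) (inG x Ax).
  by exists y, z, u; rewrite /e gy gz gu eqxx.
- move=> x Ax.
  have [y [z [u [[/up[Ay gy] /up[Az gz] /up[Au gu]] [exy exz euy euz]]]]] :=
    pent_twist (pEF _) (inG x Ax).
  by exists y, z, u; rewrite /e gy gz gu eqxx.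
Qed.
End Glue.

(** * From the operation to the geometry *)

Section Geometry.
Variables (T : finType) (e : rel T) (f : T -> T -> T).
Hypothesis pT : pent_on [set: T] e f.

Let sym x y : e x y = e y x.
Proof. by apply: (pent_sym pT); rewrite inE. Qed.
Let irr x : e x x = false.
Proof. by apply: (pent_irr pT); rewrite inE. Qed.
Let idem x : f x x = x.
Proof. by apply: (pent_idem pT); rewrite inE. Qed.
Let comm x y : ~~ e x y -> f x y = f y x.
Proof. by apply: (pent_comm pT); rewrite inE. Qed.
Let lineP x y : ~~ e x y -> ~~ e x (f x y) /\ f x (f x y) = y.
Proof. by apply: (pent_line pT); rewrite inE. Qed.
Let opp x y z : e x y -> e x z -> ~~ e y z /\ e x (f y z).
Proof. by apply: (pent_opp pT); rewrite inE. Qed.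
Let deg x : #|[set y | e x y]| = 9.
Proof. by rewrite -(pent_deg pT (in_setT x)); apply: eq_card => y; rewrite !inE. Qed.
Let square x : exists y z u, [/\ e x y, e x z, e u y, e u z & (y != z) && (u != x)].
Proof. by have [y [z [u [_ H]]]] := pent_square pT (in_setT x); exists y, z, u. Qed.
Let twist x : exists y z u, [/\ e x y, e x z, e u y & ~~ e u z].
Proof. by have [y [z [u [_ H]]]] := pent_twist pT (in_setT x); exists y, z, u. Qed.

Let third_neq x y : x != y -> ~~ e x y -> (f x y != x) && (f x y != y).
Proof.
move=> nxy nE; apply/andP; split; apply: contraNneq nxy => fE.
  by have [_] := lineP nE; rewrite fE idem => ->.
have nE' : ~~ e y x by rewrite sym.
by have [_] := lineP nE'; rewrite -(comm nE) fE idem => ->.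
Qed.

Definition join (x y : T) : {set T} := [set x; y; f x y].

Definition pent_lines : {set {set T}} :=
  [set join p.1 p.2 | p : T * T & (p.1 != p.2) && ~~ e p.1 p.2].

Let joinC x y : ~~ e x y -> join x y = join y x.
Proof. by move=> nE; rewrite /join (setUC [set x]) comm. Qed.

Let join_third x y : ~~ e x y -> join x (f x y) = join x y.
Proof.
by move=> nE; rewrite /join; have [_ ->] := lineP nE; rewrite -setUA (setUC [set f x y]) setUA.
Qed.

Let mem_pent_lines x y : x != y -> ~~ e x y -> join x y \in pent_lines.
Proof. by move=> nxy nE; apply/imsetP; exists (x, y) => //; rewrite inE nxy. Qed.

(** Total symmetry of the operation: any two of [a], [b] and [f a b] have the
    same join [join a b]. *)
Let line_join l x y : l \in pent_lines -> x \in l -> y \in l -> x != y ->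
  ~~ e x y /\ l = join x y.
Proof.
case/imsetP=> -[a b] /[!inE] /= /andP[nab nE] ->.
pose P u v := ~~ e u v /\ join a b = join u v.
have PC u v : P u v -> P v u by rewrite /P sym => -[nvu ->]; rewrite nvu joinC // sym.
have Pab : P a b by [].
have Paf : P a (f a b) by split; [case: (lineP nE) | rewrite join_third].
have Pbf : P b (f a b).
  have [nba jba] := PC _ _ Pab; rewrite comm // /P join_third //.
  by split=> //; case: (lineP nba).
move=> /[!inE] /orP[/orP[]|] /eqP-> /orP[/orP[]|] /eqP->; rewrite ?eqxx // => _.
all: by [|apply: PC].
Qed.

Let mem_join x y : (x \in join x y) * (y \in join x y).
Proof. by rewrite !inE !eqxx orbT. Qed.

(** For [x] itself a line through [x] has to be exhibited: two points missed by
    a common point are collinear, and the 4-cycle at [x] provides such a pair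
    containing [x]. *)
Lemma collinear_pent x y : collinear pent_lines x y = ~~ e x y.
Proof.
apply/existsP/idP => [[l /and3P[lL xl yl]] | nE].
  have [->|nxy] := eqVneq x y; first by rewrite irr.
  by have [] := line_join lL xl yl nxy.
have [<-|nxy] := eqVneq x y; last first.
  by exists (join x y); rewrite mem_pent_lines // !mem_join.
have [z [_ [u [exz _ euz _ /andP[_ nux]]]]] := square x.
exists (join x u); rewrite mem_pent_lines ?mem_join //; first by rewrite eq_sym.
by have [] := @opp z x u; rewrite // sym.
Qed.

Lemma deficiency_pent x y : deficiency pent_lines x y = e x y.
Proof. by rewrite /deficiency /= collinear_pent negbK. Qed.

Lemma card_pent_line l : l \in pent_lines -> #|l| = 3.
Proof.
case/imsetP=> -[a b] /[!inE] /= /andP[nab nE] ->.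
have /andP[na nb] := third_neq nab nE.
by rewrite /join -setUA cardsU1 cards2 !inE negb_or nab eq_sym na eq_sym nb.
Qed.

(** The lines through [x] partition the points collinear with and distinct from
    [x] into pairs, and there are [#|T| - 1 - 9] such points. *)
Lemma card_pencil x : #|[set l in pent_lines | x \in l]|.*2 + 10 = #|T|.
Proof.
pose Y := [set y | (x != y) && ~~ e x y].
have -> : [set l in pent_lines | x \in l] = join x @: Y.
  apply/setP=> l; rewrite inE; apply/andP/imsetP => [[lL xl]|[y]].
    have [y] : exists y, y \in l :\ x.
      by apply/set0Pn; rewrite -card_gt0 -(ltn_add2l (x \in l)) -cardsD1 xl card_pent_line.
    rewrite !inE eq_sym => /andP[nxy yl]; have [nE ->] := line_join lL xl yl nxy.
    by exists y; rewrite ?inE ?nxy.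
  by rewrite inE => /andP[nxy nE] ->; rewrite mem_pent_lines // mem_join.
have cY : #|Y| = #|join x @: Y|.*2.
  rewrite -sum1_card (partition_big_imset (join x)) /= -muln2 -sum_nat_const.
  apply: eq_bigr => l /imsetP[y /[!inE] /andP[nxy nE] ->].
  have [nEf ff] := lineP nE; have /andP[nf1 nf2] := third_neq nxy nE.
  rewrite sum1dep_card -[RHS]/(2) -[2]/(true + 1); rewrite -(eq_sym y (f x y)) in nf2 *.
  have -> : [set z in Y | join x z == join x y] = [set y; f x y].
    apply/setP=> z; rewrite !inE; apply/andP/orP.
      case=> /andP[nxz nEz] /eqP jE; have : z \in join x y by rewrite -jE mem_join.
      by rewrite !inE eq_sym (negbTE nxz) /= => /orP.
    case=> /eqP->; first by rewrite nxy nE.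
    by rewrite eq_sym nf1 nEf join_third.
  by rewrite cards2 nf2.
rewrite -cY -(cardC (mem Y)).
have -> : #|[predC Y]| = #|x |: [set y | e x y]|.
  by apply: eq_card => y; rewrite !inE negb_and !negbK eq_sym.
by rewrite cardsU1 inE irr deg.
Qed.

Let nbr x : design T :=
  Design [set y | e x y] [set l in pent_lines | l \subset [set y | e x y]].

Lemma is_opp_nbr x : is_opp pent_lines 3 9 x (nbr x).
Proof.
split=> /=.
- by apply/setP=> y; rewrite !inE collinear_pent negbK.
- by apply/subsetP=> l; rewrite inE => /andP[].
split=> /=; first exact: deg.
  by move=> l; rewrite inE => /andP[lL sl]; rewrite card_pent_line.
move=> y z; rewrite !inE => xy xz nyz; have [nE exf] := opp xy xz.
exists (join y z); split.
  rewrite !mem_join inE mem_pent_lines //=; split=> //.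
  by apply/subsetP=> u; rewrite !inE => /orP[/orP[]|] /eqP->.
by move=> l []; rewrite inE => /andP[lL _] yl zl; have [] := line_join lL yl zl nyz.
Qed.

Lemma PENT_pent r : #|T| = r.*2 + 10 -> PENT pent_lines 3 r 9.
Proof.
move=> cT; split.
- move=> x y nxy l m lL mL xl yl xm ym.
  by have [_ ->] := line_join lL xl yl nxy; have [_ ->] := line_join mL xm ym nxy.
- exact: card_pent_line.
- by move=> x; have := card_pencil x; lia.
- by move=> x; exists (nbr x); apply: is_opp_nbr.
Qed.

(** Triangles are excluded because two points missed by [a] are collinear. The
    hypothesis on [C], closure under adjacency, covers both a component and the
    whole graph. *)
Lemma has_girth_pent (C : {set T}) x :
  x \in C -> (forall y z, y \in C -> e y z -> z \in C) ->
  has_girth (deficiency pent_lines) C 4.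
Proof.
move=> Cx Ccl; split.
  have [y [z [u [xy xz uy uz /andP[nyz nux]]]]] := square x.
  have Cy := Ccl _ _ Cx xy; have Cz := Ccl _ _ Cx xz.
  have Cu : u \in C by apply: (Ccl y); rewrite // sym.
  exists [:: x; y; u; z] => //; split=> //.
    apply/andP; split; first by rewrite /= !deficiency_pent xy uz sym uy sym xz.
    have neq v w : e v w -> (v == w) = false.
      by move=> vw; apply: contraTF vw => /eqP->; rewrite irr.
    rewrite /= !inE (neq x y) // (neq x z) // (neq u z) // (eq_sym x u) (negbTE nux).
    by rewrite (negbTE nyz) (neq y u) // sym.
  by move=> v; rewrite !inE => /or4P[] /eqP->.
move=> c [s3 /andP[cyc _] _].
case: c s3 cyc => [|a [|b [|d [|? ?]]]] //= _.
rewrite !deficiency_pent => /and4P[ab bd da _].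
by have [] := @opp a b d; rewrite // ?bd // sym.
Qed.

(** In an opposite design pair all points of one side miss the same 9 points,
    whereas [pent_twist] gives two points missed by [x] that some [u] tells
    apart. *)
Lemma not_opposite_pent :
  ~ exists D1 D2, opposite_design_pair pent_lines 3 9 D1 D2.
Proof.
case=> D1 [D2 [[[c1 _ _] _] _ _ o1 o2]].
have [x Dx] : exists x, x \in dpoints D1 by apply/set0Pn; rewrite -card_gt0 c1.
have n1 x' : x' \in dpoints D1 -> dpoints D2 = [set y | e x' y].
  case/o1=> -> _ _; apply/setP=> y; by rewrite !inE collinear_pent negbK.
have n2 x' : x' \in dpoints D2 -> dpoints D1 = [set y | e x' y].
  case/o2=> -> _ _; apply/setP=> y; by rewrite !inE collinear_pent negbK.
have [y [z [u [xy xz uy nuz]]]] := twist x.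
have Dy : y \in dpoints D2 by rewrite (n1 x) // inE.
have Dz : z \in dpoints D2 by rewrite (n1 x) // inE.
have : u \in dpoints D1 by rewrite (n2 y) // inE sym.
by rewrite (n2 z) // inE sym (negbTE nuz).
Qed.

Lemma pent_geometry r : #|T| = r.*2 + 10 -> separated [set: T] e ->
  [/\ PENT pent_lines 3 r 9, type_D pent_lines 3 9 &
      forall C : {set T}, C \in components (deficiency pent_lines) ->
        has_girth (deficiency pent_lines) C 4].
Proof.
move=> cT [c [[a _ ca] [b _ cb] ce]].
split; [exact: PENT_pent | split | ].
- move=> /(_ a b) /connectP[p]; elim: p a ca => [|d p IH] a ca /=.
    by move=> _ eb; rewrite eb ca in cb.
  rewrite deficiency_pent => /andP[ad pd] bl; apply: (IH d) => //.
  by rewrite -(ce a d) ?inE.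
- by apply: (@has_girth_pent _ a).
- exact: not_opposite_pent.
move=> C /imsetP[x _ ->]; apply: (@has_girth_pent _ x); first by rewrite inE.
move=> y z; rewrite !inE => xy yz; apply: connect_trans xy (connect1 _).
by rewrite deficiency_pent.
Qed.

End Geometry.

Lemma split_pent_geometry r : split_pent_size (r + 5).*2 ->
  exists (T : finType) (lines : {set {set T}}),
    [/\ PENT lines 3 r 9, type_D lines 3 9 &
        forall C : {set T}, C \in components (deficiency lines) ->
          has_girth (deficiency lines) C 4].
Proof.
case=> P [A [e [f [cA pA sA]]]].
have cv : #|A| = #|[set: 'I_(r + 5).*2]| by rewrite cA cardsT card_ord.
have [e' [f' [pT /(_ sA) sT]]] := pent_transport cv pA.
exists 'I_(r + 5).*2, (pent_lines e' f').
by apply: (pent_geometry pT _ sT); rewrite card_ord doubleD.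
Qed.

(** * A group divisible design of type (2n)^3 (2t)^1 *)

(** A point of a doubled block: the index of its group, one of the four
    elements of [bool * bool], and one of the two copies. *)
Definition weighted : Type := ((bool * bool) * bool)%type.

(** The eight nonzero vectors of the plane over the field with 3 elements, with
    the four pairs of opposite vectors as groups. *)
Definition vec (w : weighted) : nat * nat :=
  let: (c, s) := w in
  let: (a, b) := match c with
    | (false, false) => (1, 2) | (false, true) => (1, 0)
    | (true, false) => (1, 1) | (true, true) => (0, 1) end in
  if s then (2 * a %% 3, 2 * b %% 3) else (a, b).

Definition unvec (p : nat * nat) : weighted :=
  match p with
  | (1, 2) => ((false, false), false) | (2, 1) => ((false, false), true)
  | (1, 0) => ((false, true), false) | (2, 0) => ((false, true), true)
  | (1, 1) => ((true, false), false) | (2, 2) => ((true, false), true)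
  | (0, 1) => ((true, true), false) | _ => ((true, true), true)
  end.

(** The affine lines missing the origin are the triples of nonzero vectors with
    sum zero that are not contained in a single group; [2] is [-1] modulo 3. *)
Definition affine_third (w z : weighted) : weighted :=
  unvec (2 * ((vec w).1 + (vec z).1) %% 3, 2 * ((vec w).2 + (vec z).2) %% 3).

(** On the three groups other than [(true, true)], whose indices have sum
    [(true, true)], the blocks are the transversals with copies of even sum. *)
Definition latin_third (w z : weighted) : weighted :=
  ((~~ (w.1.1 (+) z.1.1), ~~ (w.1.2 (+) z.1.2)), w.2 (+) z.2).

Definition third (full : bool) (w z : weighted) : weighted :=
  if full then affine_third w z else latin_third w z.

(** The group that gets truncated. *)
Definition infinity : bool * bool := (true, true).

Lemma third_blocks full (w z : weighted) :
  w.1 != z.1 -> full || (w.1 != infinity) && (z.1 != infinity) ->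
  [/\ third full w z = third full z w, third full w (third full w z) = z,
      (third full w z).1 != w.1, (third full w z).1 != z.1 &
      full || ((third full w z).1 != infinity)].
Proof. by case: w z full => [[[] []] []] [[[] []] []] [] //. Qed.

Section GDD.
Variables (n t : nat).
Hypotheses (n_gt1 : 1 < n) (n_odd : odd n) (t_le : t <= n).

Import GRing.Theory.
Local Open Scope ring_scope.

Let R := 'Z_n.

(** The groups correspond to the directions [(1, -1)], [(1, 0)], [(1, 1)] and
    [(0, 1)]. Any two of them have determinant 1, 2 or the opposite, which are
    units as [n] is odd: this is what makes them define a transversal
    design. *)
Definition alpha (c : bool * bool) : R := (c != infinity)%:R.
Definition beta (c : bool * bool) : R :=
  match c with
  | (false, false) => -1 | (false, true) => 0 | _ => 1
  end.

Definition det (c d : bool * bool) : R := alpha c * beta d - alpha d * beta c.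

Lemma det_unit c d : c != d -> det c d \is a GRing.unit.
Proof.
have u2 : (2%:R : R) \is a GRing.unit by rewrite unitZpE // coprimen2.
have u2n : (-2%:R : R) \is a GRing.unit by rewrite unitrN.
have u1 : (-1 : R) \is a GRing.unit by rewrite unitrN1.
case: c d => [[] []] [[] []] //= _; rewrite /det /alpha /beta /=.
all: rewrite ?(mulr1, mul1r, mulr0, mul0r, subr0, sub0r, opprK, mulrN, mulNr) //.
all: rewrite -?opprD ?unitrN ?unitr1 //.
Qed.

(** A block is a pair of parameters [b]; it meets group [c] in the value at [b]
    of the linear form of direction [c]. *)
Definition coord (c : bool * bool) (b : R * R) : R :=
  alpha c * b.1 + beta c * b.2.

(** The block through two points of distinct groups, by Cramer's rule. *)
Definition block (c : bool * bool) (x : R) (d : bool * bool) (y : R) : R * R :=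
  ((x * beta d - y * beta c) / det c d, (alpha c * y - alpha d * x) / det c d).

Lemma blockC c x d y : block c x d y = block d y c x.
Proof.
have e : det c d = - det d c by rewrite /det; ring.
by rewrite /block e invrN; congr (_, _); ring.
Qed.

Lemma coord_block c x d y : c != d -> coord c (block c x d y) = x.
Proof.
move=> /det_unit u; rewrite /coord /block /=.
rewrite !mulrA -mulrDl; apply: (mulIr u); rewrite divrK // /det; ring.
Qed.

Lemma block_coord c d b : c != d -> block c (coord c b) d (coord d b) = b.
Proof.
move=> /det_unit u; rewrite /coord /block; case: b => p q /=.
by congr (_, _); apply: (mulIr u); rewrite divrK // /det; ring.
Qed.

Definition gpoint : finType := ((bool * bool) * R * bool)%type.

Definition below (x : R) : bool := (x < t)%N.

Definition gpoints : {set gpoint} :=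
  [set p : gpoint | (p.1.1 == infinity) ==> below p.1.2].

Definition pair_block (p q : gpoint) : R * R :=
  block p.1.1 p.1.2 q.1.1 q.1.2.

(** A block that meets the truncated group in a deleted point has only three
    points left, and is doubled into a Latin square instead of an affine
    plane. *)
Definition gthird (p q : gpoint) : gpoint :=
  let b := pair_block p q in
  let: (k, s) := third (below b.2) (p.1.1, p.2) (q.1.1, q.2) in
  ((k, coord k b), s).

Lemma gthirdE p q b w : pair_block p q = b ->
  third (below b.2) (p.1.1, p.2) (q.1.1, q.2) = w ->
  gthird p q = ((w.1, coord w.1 b), w.2).
Proof. by rewrite /gthird => -> ->; case: w. Qed.

Lemma pair_blockC p q : pair_block p q = pair_block q p.
Proof. exact: blockC. Qed.

Lemma coord_infinity b : coord infinity b = b.2.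
Proof. by rewrite /coord /alpha /beta /=; ring. Qed.

(** A point of the truncated group lies only on blocks of size 4. *)
Lemma below_inf p q : p \in gpoints -> q \in gpoints -> p.1.1 != q.1.1 ->
  below (pair_block p q).2 || (p.1.1 != infinity) && (q.1.1 != infinity).
Proof.
have b_inf r r' : r.1.1 = infinity -> r'.1.1 != infinity -> r \in gpoints ->
    below (pair_block r r').2.
  rewrite inE => er nr'; rewrite er eqxx implyTb.
  by rewrite -coord_infinity /pair_block er coord_block // eq_sym.
move=> Ap Aq npq; case: eqVneq => [ep | _].
  by rewrite b_inf // -ep eq_sym.
case: eqVneq => [eq | _]; last by rewrite orbT.
by rewrite /pair_block blockC b_inf // -eq.
Qed.

Lemma gthird_gdd : gdd_on gpoints (fun p => p.1.1) gthird.
Proof.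
split=> p q Ap Aq npq; have bi := below_inf Ap Aq npq.
all: have [tC tK nk1 nk2 fk] :=
  third_blocks (w := (p.1.1, p.2)) (z := (q.1.1, q.2)) npq bi.
all: set b := pair_block p q in bi tC tK nk1 nk2 fk.
all: set w := third _ _ _ in tC tK nk1 nk2 fk.
all: have eE : gthird p q = ((w.1, coord w.1 b), w.2) by apply: gthirdE.
- rewrite eE /=; split=> //; rewrite inE.
  by apply/implyP=> /eqP /= kinf; move: fk; rewrite kinf coord_infinity eqxx orbF.
- by rewrite eE (@gthirdE _ _ b w) // pair_blockC.
- have eb : pair_block p (gthird p q) = b.
    rewrite eE /pair_block /=.
    by rewrite -{1}(coord_block p.1.2 q.1.2 npq) block_coord // eq_sym.
  rewrite (gthirdE eb (w := (q.1.1, q.2))); last by rewrite eE -[RHS]tK; case: (w).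
  rewrite /= /b /pair_block blockC coord_block 1?eq_sym //.
  by case: (q) => [[]].
Qed.

Lemma card_below : #|[set x : R | below x]| = t.
Proof.
rewrite -sum1_card (eq_bigl (fun x : R => (x < t)%N)); last by move=> x; rewrite inE.
have t_le' : (t <= (Zp_trunc n).+2)%N by rewrite Zp_cast.
by rewrite -(big_ord_widen _ (fun=> 1%N) t_le') sum1_card card_ord.
Qed.

Lemma card_group c :
  #|[set p in gpoints | p.1.1 == c]| = if c == infinity then t.*2 else n.*2.
Proof.
pose X : {set R} := if c == infinity then [set x : R | below x] else setT.
transitivity #|setX (setX [set c] X) [set: bool]|.
  apply: eq_card => -[[d x] s]; rewrite !inE /= andbT andbC; case: eqVneq => //= ->.
  by rewrite /X; case: eqVneq; rewrite inE.
rewrite !cardsX cards1 cardsT card_bool mul1n muln2 /X.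
by case: ifP => _; rewrite ?card_below ?cardsT ?card_ord ?Zp_cast.
Qed.

Lemma card_gpoints : #|gpoints| = (3 * n + t).*2.
Proof.
have -> : #|gpoints| = (\sum_c #|[set p in gpoints | p.1.1 == c]|)%N.
  rewrite -sum1_card (partition_big (fun p => p.1.1) predT) //=.
  by apply: eq_bigr => c _; rewrite -sum1_card; apply: eq_bigl => p; rewrite !inE.
rewrite (eq_bigr _ (fun c _ => card_group c)) (bigD1 infinity) //=.
rewrite (eq_bigr (fun=> n.*2)) => [|c /negbTE-> //].
rewrite sum_nat_const.
have -> : #|[pred c | c != infinity]| = 3%N.
  by have := cardC1 infinity; rewrite card_prod card_bool.
lia.
Qed.

Lemma pent_triple_plus : pent_size n.*2 -> pent_size t.*2 ->
  split_pent_size (3 * n + t).*2.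
Proof.
move=> pn pt; rewrite -card_gpoints.
pose p (c : bool * bool) : gpoint := ((c, 0), false).
have pP c : c != infinity -> p c \in gpoints by rewrite inE /= => /negbTE->.
apply: (glue gthird_gdd _ (pP (false, false) isT) (pP (false, true) isT)) => //.
by move=> c; rewrite card_group; case: ifP.
Qed.

End GDD.

(** * Geometries with a semiregular cyclic automorphism group *)

Section Cyclic.
Variables (s m' : nat).
Let m := m'.+1.
(** Points are pairs of an orbit [i < s] and a residue modulo [m]. The value
    [F i j d] is the third point on the line through [(i, 0)] and [(j, d)], and
    [None] when these points are not collinear. A pair [(j, d)] also denotes the
    displacement from a point [(i, x)] to [(j, x + d)]. *)
Variable F : nat -> nat -> nat -> option (nat * nat).

Definition dif (x y : nat) : nat := (y + (m - x)) %% m.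

Definition nbrs (i : nat) : seq (nat * nat) :=
  [seq p <- [seq (j, d) | j <- iota 0 s, d <- iota 0 m] | F i p.1 p.2 == None].

Definition at_dif (p q : nat * nat) : option (nat * nat) :=
  F p.1 q.1 (dif p.2 q.2).

Definition moved (p q : nat * nat) : nat * nat := (q.1, (p.2 + q.2) %% m).

Definition line_check (i j d : nat) : bool :=
  if F i j d is Some (k, c) then
    [&& k < s, c < m, F i k c == Some (j, d) &
        F j i (dif d 0) == Some (k, dif d c)]
  else F j i (dif d 0) == None.

Definition opp_check (i : nat) : bool :=
  all (fun p => all (fun q =>
    if at_dif p q is Some r then at_dif (i, 0) (moved p r) == None else false)
    (nbrs i)) (nbrs i).

Definition square_check (i : nat) : bool :=
  has (fun p => has (fun q => has (fun r =>
    [&& p != q, moved p r != (i, 0) & at_dif q (moved p r) == None])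
    (nbrs p.1)) (nbrs i)) (nbrs i).

Definition twist_check (i : nat) : bool :=
  has (fun p => has (fun q => has (fun r => at_dif q (moved p r) != None)
    (nbrs p.1)) (nbrs i)) (nbrs i).

(** All the conditions in [pent_on] are invariant under translation, so each is
    tested with its first point in position 0 of its orbit. *)
Definition cyclic_check : bool :=
  all (fun i => [&& F i i 0 == Some (i, 0),
    all (fun j => all (line_check i j) (iota 0 m)) (iota 0 s),
    size (nbrs i) == 9, opp_check i, square_check i & twist_check i])
  (iota 0 s).

Let P : finType := ('I_s * 'I_m)%type.

Import GRing.Theory.

Let gap (x y : P) : nat := (y.2 - x.2)%R.

Let e : rel P := fun x y => F x.1 y.1 (gap x y) == None.

Let go (x : P) (q : nat * nat) : P := (insubd x.1 q.1, x.2 + inord q.2)%R.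

Let f (x y : P) : P := if F x.1 y.1 (gap x y) is Some q then go x q else x.

Let displ (x y : P) : nat * nat := (y.1 : nat, gap x y).

Let dif_val (a b : 'I_m) : dif a b = (b - a)%R :> nat.
Proof. by rewrite /dif /= modnDmr. Qed.

Let gap_dif x y z : gap y z = dif (gap x y) (gap x z).
Proof. by rewrite /gap dif_val; congr val; rewrite opprB addrA subrK. Qed.

Let gapxx x : gap x x = 0.
Proof. by rewrite /gap subrr. Qed.

Let gap_lt x y : gap x y < m. Proof. exact: ltn_ord. Qed.

Let displ_inj x : injective (displ x).
Proof.
move=> [y1 y2] [z1 z2] [/val_inj -> /val_inj /(congr1 (fun a => a + x.2)%R)].
by rewrite /= !subrK => ->.
Qed.

Let go_displ x q : q.1 < s -> q.2 < m -> displ x (go x q) = q.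
Proof.
case: q => k c ks cm; congr (_, _); first by rewrite val_insubd ks.
have -> : gap x (go x (k, c)) = (inord c : 'I_m) by congr val; rewrite [LHS]addrC addKr.
exact: inordK.
Qed.

Let mem_nbrs x y : (displ x y \in nbrs x.1) = e x y.
Proof.
rewrite mem_filter andb_idr // => _.
by apply/allpairsPdep; exists (y.1 : nat), (gap x y); rewrite !mem_iota /= ltn_ord gap_lt.
Qed.

Let nbrsP (x : P) q : q \in nbrs x.1 -> exists2 y, e x y & q = displ x y.
Proof.
move=> qN; have : displ x (go x q) = q.
  move: qN; rewrite mem_filter => /andP[_ /allpairsPdep[k [c []]]].
  by rewrite !mem_iota => ks cm ->; apply: go_displ.
by move=> qE; exists (go x q); rewrite -?mem_nbrs ?qE.
Qed.

Let at_difE (x y z : P) : at_dif (displ x y) (displ x z) = F y.1 z.1 (gap y z).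
Proof. by rewrite /at_dif /= -gap_dif. Qed.

Let movedE (x y z : P) : moved (displ x y) (displ y z) = displ x z.
Proof. congr (_, _); rewrite /gap -[LHS]/(val ((y.2 - x.2) + (z.2 - y.2))%R).
by congr val; rewrite addrC subrKA. Qed.

Hypothesis chk : cyclic_check.

Let chkP (i : 'I_s) : [/\ F i i 0 = Some (i : nat, 0),
   forall (j : 'I_s) d, d < m -> line_check i j d,
   size (nbrs i) = 9, opp_check i & square_check i /\ twist_check i].
Proof.
have /(allP chk) : (i : nat) \in iota 0 s by rewrite mem_iota ltn_ord.
case/and5P=> /eqP F0 /allP lc /eqP sz oc /andP[sc tc]; split=> // j d dm.
have /lc/allP : (j : nat) \in iota 0 s by rewrite mem_iota ltn_ord.
by apply; rewrite mem_iota.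
Qed.

Let lineF (x y : P) q : F x.1 y.1 (gap x y) = Some q -> let z := f x y in
  [/\ q = displ x z, F x.1 z.1 (gap x z) = Some (displ x y) &
      F y.1 x.1 (gap y x) = Some (displ y z)].
Proof.
move=> Fq; have [_ /(_ y.1 (gap x y) (gap_lt _ _)) lc _ _ _] := chkP x.1.
case: q Fq => k c Fq; move: lc; rewrite /line_check Fq /= => /and4P[ks cm /eqP F1 /eqP F2].
have fE : displ x (f x y) = (k, c) by rewrite /f Fq go_displ.
have -> : gap y x = dif (gap x y) 0 by rewrite (gap_dif x) gapxx.
split=> //.
  by move: fE => [-> ->].
by rewrite F2 /displ (gap_dif x y); case: fE => -> ->.
Qed.

Let e_sym : symmetric e.
Proof.
have H x y : e x y -> e y x.
  rewrite /e => /eqP Fxy.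
  have [_ /(_ y.1 (gap x y) (gap_lt _ _)) + _ _ _] := chkP x.1.
  by rewrite /line_check Fxy (gap_dif x y) gapxx.
by move=> x y; apply/idP/idP => /H.
Qed.

Let not_e (x y : P) : ~~ e x y -> exists q, F x.1 y.1 (gap x y) = Some q.
Proof. by rewrite /e; case: (F _ _ _) => [q|//]; exists q. Qed.

Lemma cyclic_pent : pent_size (s * m).
Proof.
exists P, setT, e, f; split; first by rewrite cardsT card_prod !card_ord.
split=> //.
- by move=> x _; rewrite /e gapxx; have [-> _ _ _ _] := chkP x.1.
- move=> x _; apply: (@displ_inj x); rewrite /f gapxx.
  by have [-> _ _ _ _] := chkP x.1; rewrite go_displ //= /displ gapxx.
- move=> x y _ _ /not_e[q Fq]; have [_ _ F2] := lineF Fq.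
  apply: (@displ_inj y); have [qE _ _] := lineF F2.
  by rewrite -qE.
- move=> x y _ _ /not_e[q Fq]; have [_ F1 _] := lineF Fq.
  split; first by rewrite /e F1.
  by have [/displ_inj] := lineF F1.
- move=> x y z _ _ _ exy exz; have [_ _ _ oc _] := chkP x.1.
  have /allP/(_ (displ x y)) := oc; rewrite mem_nbrs => /(_ exy).
  move=> /allP/(_ (displ x z)); rewrite mem_nbrs => /(_ exz).
  rewrite at_difE /e; case Fq: (F _ _ _) => [q|//].
  have [-> _ _] := lineF Fq; rewrite movedE.
  have -> : (x.1 : nat, 0) = displ x x by rewrite /displ gapxx.
  by rewrite at_difE => ->.
- move=> x _; have [_ _ <- _ _] := chkP x.1.
  have un : uniq (nbrs x.1).
    by apply: filter_uniq; apply: allpairs_uniq; rewrite ?iota_uniq // => -[? ?] [? ?].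
  rewrite cardE -(size_map (displ x)); apply/perm_size/uniq_perm => //.
    by rewrite map_inj_uniq ?enum_uniq //; apply: displ_inj.
  move=> q; apply/mapP/idP => [[y]|/nbrsP[y exy ->]].
    by rewrite mem_enum !inE => exy ->; rewrite mem_nbrs.
  by exists y; rewrite // mem_enum !inE.
- move=> x _; have [_ _ _ _ [/hasP[p /nbrsP[y exy ->]]]] := chkP x.1.
  case/hasP=> _ /nbrsP[z exz ->] /hasP[_ /nbrsP[u eyu ->]] + _.
  rewrite movedE at_difE => /and3P[nyz nux ezu].
  exists y, z, u; split=> //; rewrite ![e u _]e_sym; split=> //.
  by apply/andP; split; [apply: contraNneq nyz | apply: contraNneq nux]; move=> ->; rewrite // /displ gapxx.
- move=> x _; have [_ _ _ _ [_ /hasP[p /nbrsP[y exy ->]]]] := chkP x.1.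
  case/hasP=> _ /nbrsP[z exz ->] /hasP[_ /nbrsP[u eyu ->]].
  rewrite movedE at_difE => ezu.
  by exists y, z, u; split=> //; rewrite ![e u _]e_sym.
Qed.

End Cyclic.

(** * The starting geometries *)

(** Row [i * s + j] lists the third points for the orbits [i] and [j], by
    difference. *)
Definition third_table : Type := seq (seq (option (nat * nat))).

Section Table.
Variables s m' : nat.

Definition read (T : third_table) (i j d : nat) : option (nat * nat) :=
  nth None (nth [::] T (i * s + j)) d.

Definition write (T : third_table) (p q r : nat * nat) : third_table :=
  let k := p.1 * s + q.1 in
  set_nth [::] T k
    (set_nth None (nth [::] T k) (dif m' p.2 q.2) (Some (r.1, dif m' p.2 r.2))).

(** A block lists three points, [i * m + x] standing for [(i, x)]; it is recorded
    for each ordering of its points, all translates being thereby covered. *)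
Definition write_block (b : nat * nat * nat) (T : third_table) : third_table :=
  let pt x := (x %/ m'.+1, x %% m'.+1) in
  let: (x, y, z) := b in
  let: (p, q, r) := (pt x, pt y, pt z) in
  write (write (write (write (write (write T p q r) q p r) p r q) r p q) q r p)
    r q p.

(** The lines are the translates of the blocks; the first entries are those for
    a point and itself. *)
Definition develop (blocks : seq (nat * nat * nat)) : third_table :=
  foldr write_block
    (foldr (fun i T => write T (i, 0) (i, 0) (i, 0)) [::] (iota 0 s)) blocks.

End Table.

(** In each geometry the deficiency graph is the union of the complete bipartite
    graphs between the lines L and M of some orbits of pairs, and the three
    lines facing a given point in this way form a parallel class of the affine
    plane on the points that it misses. For h = 15 it is the Petersen graph
    with every vertex replaced by three independent ones, and the geometry is
    built likewise on the Desargues configuration. For the other odd h there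
    are two orbits, the graph is bipartite, and the points missed by (0, 0) are
    the (1, l + m) with l in L and m in M, two sets of size 3; when 3 divides h,
    L is the subgroup of order 3. For even h there are four orbits. The
    remaining lines solve an exact cover problem on the differences left
    over. *)
Definition blocks15 : seq (nat * nat * nat) := [::
   (0, 2, 16); (0, 3, 24); (0, 5, 10); (0, 7, 26); (0, 17, 28); (0, 18, 27);
   (0, 22, 23); (15, 20, 25)].

Definition blocks39 : seq (nat * nat * nat) := [::
   (0, 1, 62); (0, 2, 35); (0, 3, 8); (0, 7, 24); (0, 9, 28); (0, 10, 50);
   (0, 12, 63); (0, 13, 26); (0, 14, 56); (0, 16, 60); (0, 18, 77); (0, 43,
   70); (0, 46, 47); (0, 48, 64); (0, 49, 57); (0, 53, 74); (0, 55, 69); (0,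
   66, 76); (0, 68, 73); (0, 72, 75); (39, 41, 45); (39, 46, 61); (39, 48,
   59); (39, 52, 65)].

Definition blocks51 : seq (nat * nat * nat) := [::
   (0, 1, 88); (0, 2, 8); (0, 3, 81); (0, 4, 75); (0, 5, 27); (0, 7, 67);
   (0, 9, 28); (0, 10, 83); (0, 11, 26); (0, 12, 64); (0, 13, 92); (0, 14,
   30); (0, 17, 34); (0, 18, 53); (0, 20, 89); (0, 54, 84); (0, 55, 56); (0,
   58, 61); (0, 62, 99); (0, 63, 98); (0, 65, 77); (0, 66, 97); (0, 70, 80);
   (0, 72, 90); (0, 82, 95); (0, 94, 101); (0, 96, 100); (51, 53, 96); (51,
   56, 78); (51, 60, 83); (51, 62, 87); (51, 68, 85)].

Definition blocks63 : seq (nat * nat * nat) := [::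
   (0, 1, 10); (0, 2, 120); (0, 3, 47); (0, 4, 39); (0, 5, 96); (0, 6, 112);
   (0, 7, 81); (0, 8, 95); (0, 11, 33); (0, 12, 32); (0, 13, 40); (0, 14,
   116); (0, 15, 92); (0, 17, 64); (0, 18, 66); (0, 21, 42); (0, 25, 69);
   (0, 26, 123); (0, 29, 90); (0, 65, 122); (0, 67, 104); (0, 68, 75); (0,
   70, 119); (0, 71, 100); (0, 76, 79); (0, 78, 86); (0, 80, 103); (0, 82,
   99); (0, 83, 121); (0, 85, 109); (0, 88, 101); (0, 89, 117); (0, 98,
   125); (0, 108, 113); (63, 64, 117); (63, 65, 110); (63, 67, 111); (63,
   74, 104); (63, 75, 106); (63, 84, 105)].

Definition blocks74 : seq (nat * nat * nat) := [::
   (0, 1, 6); (0, 2, 68); (0, 3, 91); (0, 4, 48); (0, 7, 136); (0, 9, 82);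
   (0, 10, 112); (0, 11, 37); (0, 12, 70); (0, 13, 52); (0, 14, 137); (0,
   15, 85); (0, 16, 109); (0, 17, 147); (0, 18, 146); (0, 38, 56); (0, 40,
   84); (0, 41, 143); (0, 42, 138); (0, 43, 122); (0, 45, 140); (0, 46, 97);
   (0, 47, 54); (0, 50, 78); (0, 51, 89); (0, 53, 145); (0, 55, 127); (0,
   57, 133); (0, 59, 113); (0, 60, 80); (0, 61, 117); (0, 62, 99); (0, 64,
   105); (0, 65, 67); (0, 71, 92); (0, 73, 141); (0, 74, 104); (0, 75, 120);
   (0, 77, 135); (0, 79, 126); (0, 81, 116); (0, 83, 142); (0, 86, 119); (0,
   87, 115); (0, 90, 121); (0, 94, 95); (0, 96, 100); (0, 98, 134); (0, 102,
   132); (0, 103, 118); (0, 106, 131); (0, 108, 124); (0, 111, 144); (37,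
   38, 144); (37, 40, 54); (37, 41, 76); (37, 42, 68); (37, 45, 100); (37,
   46, 124); (37, 47, 141); (37, 49, 97); (37, 50, 112); (37, 53, 138); (37,
   77, 118); (37, 79, 96); (37, 82, 104); (37, 83, 110); (37, 84, 121); (37,
   86, 105); (37, 87, 90); (37, 89, 101); (37, 91, 137); (37, 98, 107); (37,
   99, 126); (37, 103, 127); (37, 106, 119); (37, 108, 140); (37, 111, 134);
   (37, 114, 117); (37, 120, 147); (37, 123, 145); (74, 76, 82); (74, 79,
   122); (74, 87, 129); (74, 88, 128); (74, 90, 134); (74, 112, 123); (74,
   125, 137); (74, 140, 145); (111, 112, 131); (111, 113, 141); (111, 119,
   135)].

Definition blocks86 : seq (nat * nat * nat) := [::
   (0, 1, 7); (0, 2, 98); (0, 3, 46); (0, 4, 14); (0, 5, 16); (0, 8, 80);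
   (0, 9, 79); (0, 12, 144); (0, 15, 140); (0, 17, 102); (0, 18, 44); (0,
   19, 120); (0, 20, 167); (0, 21, 142); (0, 45, 73); (0, 47, 159); (0, 48,
   113); (0, 49, 116); (0, 50, 137); (0, 51, 68); (0, 52, 111); (0, 53,
   117); (0, 54, 88); (0, 55, 151); (0, 56, 83); (0, 57, 141); (0, 58, 87);
   (0, 59, 166); (0, 60, 103); (0, 61, 158); (0, 62, 112); (0, 63, 89); (0,
   64, 130); (0, 65, 133); (0, 66, 170); (0, 67, 169); (0, 74, 153); (0, 75,
   131); (0, 76, 93); (0, 81, 95); (0, 82, 145); (0, 84, 156); (0, 85, 104);
   (0, 86, 119); (0, 90, 122); (0, 91, 152); (0, 92, 114); (0, 94, 139); (0,
   97, 163); (0, 99, 106); (0, 105, 155); (0, 107, 160); (0, 108, 125); (0,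
   109, 148); (0, 110, 150); (0, 118, 135); (0, 121, 154); (0, 123, 127);
   (0, 124, 171); (0, 126, 138); (0, 129, 157); (0, 134, 165); (0, 136,
   161); (0, 149, 162); (43, 44, 80); (43, 45, 171); (43, 46, 128); (43, 47,
   129); (43, 48, 167); (43, 51, 76); (43, 52, 66); (43, 54, 144); (43, 55,
   135); (43, 56, 159); (43, 64, 97); (43, 87, 161); (43, 88, 117); (43, 89,
   141); (43, 90, 163); (43, 91, 92); (43, 94, 113); (43, 95, 136); (43, 98,
   156); (43, 99, 164); (43, 101, 138); (43, 104, 153); (43, 106, 111); (43,
   109, 124); (43, 114, 148); (43, 116, 137); (43, 118, 127); (43, 121,
   157); (43, 122, 160); (43, 123, 151); (43, 132, 134); (86, 88, 158); (86,
   92, 148); (86, 94, 117); (86, 99, 134); (86, 102, 171); (86, 104, 161);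
   (86, 129, 132); (86, 130, 140); (86, 137, 153); (129, 130, 149); (129,
   133, 138); (129, 135, 146); (129, 136, 158)].

Definition blocks89 : seq (nat * nat * nat) := [::
   (0, 1, 113); (0, 2, 141); (0, 3, 101); (0, 4, 32); (0, 5, 24); (0, 6,
   18); (0, 7, 144); (0, 8, 146); (0, 9, 64); (0, 10, 56); (0, 11, 58); (0,
   13, 133); (0, 14, 128); (0, 15, 67); (0, 16, 171); (0, 17, 103); (0, 20,
   122); (0, 21, 48); (0, 23, 129); (0, 26, 161); (0, 29, 108); (0, 30, 97);
   (0, 35, 123); (0, 36, 145); (0, 38, 115); (0, 39, 90); (0, 40, 174); (0,
   44, 107); (0, 91, 92); (0, 93, 142); (0, 94, 153); (0, 95, 167); (0, 96,
   119); (0, 100, 126); (0, 104, 124); (0, 105, 118); (0, 110, 148); (0,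
   116, 170); (0, 125, 164); (0, 127, 143); (0, 130, 159); (0, 131, 176);
   (0, 136, 172); (0, 147, 150); (0, 149, 157); (0, 151, 165); (0, 158,
   160); (0, 162, 169); (89, 93, 150); (89, 94, 159); (89, 95, 166); (89,
   98, 123); (89, 99, 132); (89, 100, 131); (89, 104, 126); (89, 110, 151)].

Definition blocks93 : seq (nat * nat * nat) := [::
   (0, 1, 34); (0, 2, 30); (0, 3, 32); (0, 4, 148); (0, 5, 87); (0, 7, 47);
   (0, 8, 166); (0, 9, 184); (0, 10, 113); (0, 12, 163); (0, 13, 58); (0,
   14, 112); (0, 15, 94); (0, 16, 57); (0, 17, 156); (0, 18, 159); (0, 19,
   134); (0, 20, 150); (0, 21, 146); (0, 22, 136); (0, 23, 129); (0, 24,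
   132); (0, 25, 67); (0, 27, 164); (0, 31, 62); (0, 37, 109); (0, 38, 119);
   (0, 39, 143); (0, 43, 107); (0, 44, 111); (0, 95, 118); (0, 96, 145); (0,
   97, 171); (0, 99, 117); (0, 100, 122); (0, 101, 169); (0, 102, 182); (0,
   105, 110); (0, 116, 140); (0, 120, 127); (0, 126, 173); (0, 128, 178);
   (0, 131, 179); (0, 133, 147); (0, 135, 162); (0, 138, 153); (0, 142,
   180); (0, 149, 170); (0, 161, 167); (0, 168, 176); (0, 177, 181); (93,
   94, 153); (93, 95, 158); (93, 96, 157); (93, 102, 175); (93, 103, 129);
   (93, 105, 146); (93, 109, 151); (93, 110, 149); (93, 124, 155)].

Definition blocks95 : seq (nat * nat * nat) := [::
   (0, 1, 82); (0, 2, 62); (0, 3, 69); (0, 4, 79); (0, 5, 114); (0, 6, 155);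
   (0, 7, 174); (0, 8, 100); (0, 9, 54); (0, 10, 111); (0, 11, 182); (0, 12,
   51); (0, 15, 146); (0, 17, 42); (0, 18, 169); (0, 19, 113); (0, 21, 166);
   (0, 22, 49); (0, 23, 176); (0, 24, 67); (0, 30, 172); (0, 31, 104); (0,
   32, 156); (0, 34, 132); (0, 36, 116); (0, 37, 144); (0, 38, 148); (0, 40,
   97); (0, 47, 129); (0, 96, 117); (0, 99, 186); (0, 102, 150); (0, 103,
   160); (0, 105, 135); (0, 106, 121); (0, 108, 141); (0, 115, 122); (0,
   118, 128); (0, 119, 130); (0, 120, 184); (0, 123, 183); (0, 125, 180);
   (0, 126, 163); (0, 127, 188); (0, 133, 138); (0, 134, 170); (0, 137,
   143); (0, 140, 158); (0, 147, 179); (0, 154, 173); (0, 157, 159); (0,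
   162, 185); (95, 96, 109); (95, 98, 124); (95, 99, 115); (95, 104, 145);
   (95, 107, 151); (95, 112, 165); (95, 117, 163); (95, 119, 147)].

Definition blocks98 : seq (nat * nat * nat) := [::
   (0, 1, 7); (0, 2, 76); (0, 3, 86); (0, 4, 9); (0, 8, 20); (0, 10, 26);
   (0, 11, 130); (0, 13, 120); (0, 14, 128); (0, 15, 179); (0, 18, 90); (0,
   19, 168); (0, 21, 78); (0, 22, 115); (0, 24, 163); (0, 49, 187); (0, 50,
   191); (0, 51, 153); (0, 52, 150); (0, 53, 181); (0, 54, 91); (0, 55,
   192); (0, 56, 106); (0, 58, 178); (0, 59, 189); (0, 60, 105); (0, 61,
   171); (0, 62, 165); (0, 63, 134); (0, 64, 183); (0, 65, 98); (0, 66,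
   190); (0, 67, 121); (0, 68, 131); (0, 69, 85); (0, 70, 102); (0, 71,
   123); (0, 73, 113); (0, 75, 103); (0, 77, 112); (0, 80, 184); (0, 81,
   122); (0, 82, 158); (0, 87, 144); (0, 89, 173); (0, 92, 118); (0, 93,
   146); (0, 94, 124); (0, 95, 132); (0, 96, 108); (0, 97, 99); (0, 100,
   104); (0, 101, 180); (0, 109, 160); (0, 110, 185); (0, 111, 139); (0,
   116, 156); (0, 117, 155); (0, 125, 161); (0, 126, 154); (0, 127, 166);
   (0, 129, 172); (0, 133, 148); (0, 135, 159); (0, 136, 167); (0, 137,
   186); (0, 141, 176); (0, 143, 157); (0, 145, 193); (0, 151, 170); (0,
   152, 175); (0, 162, 195); (0, 169, 174); (0, 177, 194); (49, 50, 71);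
   (49, 51, 167); (49, 52, 87); (49, 53, 93); (49, 55, 115); (49, 56, 88);
   (49, 57, 104); (49, 64, 134); (49, 67, 164); (49, 68, 116); (49, 69,
   149); (49, 72, 163); (49, 73, 156); (49, 98, 111); (49, 105, 161); (49,
   107, 141); (49, 108, 166); (49, 114, 180); (49, 117, 123); (49, 118,
   172); (49, 121, 140); (49, 122, 125); (49, 127, 188); (49, 129, 175);
   (49, 132, 142); (49, 136, 193); (49, 144, 171); (49, 148, 185); (49, 150,
   170); (49, 154, 158); (49, 155, 191); (49, 157, 192); (49, 162, 184);
   (49, 183, 194); (98, 99, 169); (98, 100, 191); (98, 105, 172); (98, 106,
   192); (98, 107, 176); (98, 109, 121); (98, 112, 129); (98, 114, 148);
   (98, 118, 150); (98, 120, 153); (98, 122, 194); (98, 158, 160); (98, 163,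
   188); (147, 148, 189); (147, 150, 168); (147, 153, 162)].

Definition blocks99 : seq (nat * nat * nat) := [::
   (0, 1, 26); (0, 2, 72); (0, 3, 117); (0, 4, 156); (0, 5, 133); (0, 6,
   147); (0, 7, 41); (0, 8, 40); (0, 9, 180); (0, 10, 45); (0, 11, 127); (0,
   12, 80); (0, 13, 164); (0, 14, 174); (0, 15, 194); (0, 16, 52); (0, 17,
   103); (0, 18, 153); (0, 20, 57); (0, 21, 134); (0, 22, 126); (0, 23, 51);
   (0, 24, 106); (0, 30, 168); (0, 33, 66); (0, 38, 136); (0, 39, 187); (0,
   43, 173); (0, 44, 167); (0, 46, 175); (0, 49, 149); (0, 101, 145); (0,
   102, 137); (0, 105, 144); (0, 107, 112); (0, 108, 119); (0, 109, 189);
   (0, 110, 195); (0, 111, 154); (0, 115, 184); (0, 118, 139); (0, 120,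
   196); (0, 121, 172); (0, 122, 193); (0, 131, 192); (0, 140, 155); (0,
   142, 188); (0, 143, 146); (0, 150, 166); (0, 159, 177); (0, 161, 183);
   (0, 162, 186); (0, 163, 169); (0, 170, 182); (0, 176, 178); (99, 100,
   173); (99, 103, 171); (99, 106, 164); (99, 107, 166); (99, 108, 128);
   (99, 109, 156); (99, 112, 148); (99, 116, 153); (99, 132, 165)].

Definition blocks101 : seq (nat * nat * nat) := [::
   (0, 1, 155); (0, 2, 159); (0, 3, 168); (0, 4, 147); (0, 5, 74); (0, 6,
   129); (0, 7, 48); (0, 8, 141); (0, 9, 77); (0, 10, 49); (0, 11, 102); (0,
   12, 88); (0, 14, 138); (0, 15, 134); (0, 16, 36); (0, 17, 40); (0, 18,
   128); (0, 19, 201); (0, 21, 58); (0, 22, 140); (0, 26, 115); (0, 28, 72);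
   (0, 30, 160); (0, 31, 179); (0, 34, 109); (0, 35, 187); (0, 38, 174); (0,
   42, 111); (0, 45, 132); (0, 46, 126); (0, 47, 137); (0, 50, 127); (0,
   103, 194); (0, 104, 105); (0, 106, 153); (0, 107, 142); (0, 112, 171);
   (0, 113, 135); (0, 114, 197); (0, 116, 183); (0, 117, 131); (0, 120,
   158); (0, 121, 151); (0, 122, 184); (0, 139, 195); (0, 144, 163); (0,
   146, 198); (0, 149, 199); (0, 150, 196); (0, 156, 162); (0, 164, 167);
   (0, 169, 200); (0, 172, 180); (0, 175, 177); (0, 185, 189); (101, 106,
   133); (101, 108, 161); (101, 110, 134); (101, 112, 127); (101, 113, 126);
   (101, 117, 182); (101, 118, 179); (101, 122, 165); (101, 129, 158)].

Definition blocks129 : seq (nat * nat * nat) := [::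
   (0, 1, 187); (0, 2, 155); (0, 3, 108); (0, 4, 38); (0, 5, 52); (0, 6,
   84); (0, 7, 138); (0, 8, 234); (0, 9, 48); (0, 10, 231); (0, 11, 115);
   (0, 12, 236); (0, 13, 109); (0, 15, 248); (0, 16, 204); (0, 17, 245); (0,
   18, 44); (0, 19, 75); (0, 22, 49); (0, 23, 255); (0, 28, 218); (0, 29,
   141); (0, 30, 219); (0, 31, 240); (0, 32, 68); (0, 35, 165); (0, 37,
   137); (0, 40, 194); (0, 41, 162); (0, 42, 211); (0, 43, 86); (0, 46,
   156); (0, 50, 197); (0, 53, 230); (0, 55, 237); (0, 57, 227); (0, 58,
   180); (0, 59, 135); (0, 60, 139); (0, 62, 195); (0, 63, 244); (0, 64,
   148); (0, 132, 151); (0, 134, 238); (0, 136, 168); (0, 140, 150); (0,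
   142, 257); (0, 143, 242); (0, 144, 203); (0, 145, 220); (0, 146, 183);
   (0, 149, 166); (0, 152, 212); (0, 157, 159); (0, 158, 254); (0, 160,
   161); (0, 164, 247); (0, 171, 179); (0, 173, 185); (0, 174, 216); (0,
   175, 201); (0, 176, 196); (0, 178, 202); (0, 184, 199); (0, 191, 222);
   (0, 192, 243); (0, 193, 256); (0, 198, 225); (0, 200, 235); (0, 207,
   223); (0, 214, 217); (0, 246, 252); (129, 133, 224); (129, 134, 211);
   (129, 136, 237); (129, 138, 219); (129, 140, 196); (129, 142, 214); (129,
   147, 208); (129, 151, 200); (129, 152, 217); (129, 158, 203); (129, 165,
   205); (129, 172, 215)].

(** Entries are [(h, s, m - 1, blocks)], with [s * m = 2 * h] points. *)
Definition bases : seq (nat * nat * nat * seq (nat * nat * nat)) :=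
  [:: (15, 2, 14, blocks15);
      (39, 2, 38, blocks39);
      (51, 2, 50, blocks51);
      (63, 2, 62, blocks63);
      (74, 4, 36, blocks74);
      (86, 4, 42, blocks86);
      (89, 2, 88, blocks89);
      (93, 2, 92, blocks93);
      (95, 2, 94, blocks95);
      (98, 4, 48, blocks98);
      (99, 2, 98, blocks99);
      (101, 2, 100, blocks101);
      (129, 2, 128, blocks129)].

Definition base_check (b : nat * nat * nat * seq (nat * nat * nat)) : bool :=
  let: (h, s, m', blocks) := b in
  (s * m'.+1 == h.*2) && cyclic_check s m' (read s (develop s m' blocks)).

Lemma bases_ok : all base_check bases.
Proof. by vm_compute. Qed.

Definition base_sizes : seq nat := [seq b.1.1.1 | b <- bases].

Lemma base_pent h : h \in base_sizes -> pent_size h.*2.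
Proof.
case/mapP=> -[[[h' s] m'] blocks] /(allP bases_ok) /andP[/eqP sz chk] /= ->.
by rewrite -sz; apply: cyclic_pent chk.
Qed.

(** * The attained sizes *)

Lemma pent_size_gt9 v : pent_size v -> 0 < v -> 9 < v.
Proof.
case=> P [A [e [f [<- pA]]]] /card_gt0P[x Ax].
rewrite -(pent_deg pA Ax) [X in _ < X](cardsD1 x) Ax ltnS subset_leq_card //.
apply/subsetP=> y; rewrite !inE => /andP[-> exy]; rewrite andbT.
by apply: contraTneq exy => ->; rewrite (pent_irr pA).
Qed.

Lemma pent_step n t : odd n -> t <= n -> pent_size n.*2 -> pent_size t.*2 ->
  split_pent_size (3 * n + t).*2.
Proof.
move=> on tn pn; apply: pent_triple_plus => //.
by have := pent_size_gt9 pn; case: n on {tn pn} => [|[|n]] // _ /(_ isT).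
Qed.

(** Sets of naturals are represented by their characteristic sequences, on which
    forming all [3 * n + t] amounts to inserting entries. *)
Fixpoint odd_triples (o : bool) (S : seq bool) : seq bool :=
  if S is b :: S' then [:: o && b, false, false & odd_triples (~~ o) S'] else [::].

(** [drop] and the inner [ncons] together erase the entries below [t], which are
    too small for the recursion; the outer [ncons] moves [3 * n] to
    [3 * n + t]. *)
Definition spread (t : nat) (S : seq bool) : seq bool :=
  ncons t false (odd_triples false (ncons t false (drop t S))).

Fixpoint union (S1 S2 : seq bool) : seq bool :=
  match S1, S2 with
  | b1 :: S1', b2 :: S2' => (b1 || b2) :: union S1' S2'
  | [::], _ => S2
  | _, [::] => S1
  end.

(** Only sums below 4352 matter, hence the bound on [n]; and the [t] below 560
    turn out to attain all of them. *)
Definition enlarge (S : seq bool) : seq bool :=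
  let S' := take 1452 S in
  foldr (fun t => union (spread t S')) S
    [seq t <- iota 0 560 | (t == 0) || nth false S t].

Lemma nth_odd_triples o S k : nth false (odd_triples o S) k ->
  exists n, [/\ k = 3 * n, odd n (+) o & nth false S n].
Proof.
elim: S o k => [|b S IH] o k /=; first by rewrite nth_nil.
case: k => [/andP[oo Sb]|[|[|k]]] //=; first by exists 0; rewrite addFb.
by case/IH=> n [-> on Sn]; exists n.+1; split=> //=; [lia | move: on; case: odd o => -[]].
Qed.

Lemma nth_ncons_false t S k : nth false (ncons t false S) k ->
  t <= k /\ nth false S (k - t).
Proof. by rewrite nth_ncons; case: ltnP. Qed.

Lemma nth_spread t S h : nth false (spread t S) h ->
  exists n, [/\ h = 3 * n + t, odd n, t <= n & nth false S n].
Proof.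
case/nth_ncons_false=> th /nth_odd_triples[n [hE on /nth_ncons_false[tn]]].
rewrite nth_drop subnKC // => Sn; exists n; split=> //; first lia.
by rewrite addbF in on.
Qed.

Lemma nth_union S1 S2 k :
  nth false (union S1 S2) k = nth false S1 k || nth false S2 k.
Proof.
elim: S1 S2 k => [|b1 S1 IH] [|b2 S2] [|k] //=; rewrite ?orbF ?nth_nil //.
Qed.

(** Everything above the largest starting value 129 comes from the recursion,
    and so has a disconnected deficiency graph. *)
Definition attained (S : seq bool) : Prop := forall h, nth false S h ->
  pent_size h.*2 /\ (129 < h -> split_pent_size h.*2).

Lemma attained_enlarge S : attained S -> attained (enlarge S).
Proof.
move=> aS; rewrite /enlarge; set ts := filter _ _.
have : {in ts, forall t, pent_size t.*2}.
  move=> t; rewrite mem_filter => /andP[/orP[/eqP->|/aS[]]//].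
  by move=> _; apply: pent_size0.
elim: ts => //= t ts IH pts h; rewrite nth_union => /orP[|].
  case/nth_spread=> n [-> on tn]; have [n_lt|n_ge] := ltnP n 1452; last first.
    by rewrite nth_default // size_take; case: ifP => //; lia.
  rewrite nth_take // => /aS[pn _].
  have sp := pent_step on tn pn (pts _ (mem_head _ _)).
  by split=> //; apply: split_pent_sizeW.
by apply: IH => u uts; apply: pts; rewrite inE uts orbT.
Qed.

Definition reached : seq bool :=
  iter 4 enlarge (mkseq (fun h => h \in base_sizes) 130).

Lemma reached_attained : attained reached.
Proof.
rewrite /reached; do 4![apply: attained_enlarge].
move=> h; have [h_lt|h_ge] := ltnP h 130; last by rewrite nth_default ?size_mkseq.
by rewrite nth_mkseq // => /base_pent ph; split=> //; rewrite ltnNge -ltnS h_lt.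
Qed.

Lemma all2_iota (q : pred nat) a k (S : seq bool) :
  all2 (fun h b => q h || b) (iota a k) (take k (drop a S)) ->
  forall h, a <= h < a + k -> ~~ q h -> nth false S h.
Proof.
rewrite all2E => /andP[/eqP sz /(all_nthP (0, false)) H] h /andP[ah hk] nq.
have hi : h - a < k by rewrite ltn_subLR.
have := H (h - a); rewrite size_zip -sz size_iota minnn => /(_ hi).
by rewrite nth_zip //= nth_iota // nth_take // nth_drop subnKC // (negbTE nq).
Qed.

Lemma reached_middle :
  all2 (fun h b => (h %% 3 == 1) || b) (iota 1418 2934)
    (take 2934 (drop 1418 reached)).
Proof. by vm_compute. Qed.

Lemma split_pent_middle h : 1418 <= h < 1418 + 2934 -> h %% 3 != 1 ->
  split_pent_size h.*2.
Proof.
move=> h_in h3; have [_] := reached_attained (all2_iota reached_middle h_in h3).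
by apply; case/andP: h_in => h_ge _; apply: leq_trans h_ge.
Qed.

Lemma pent60 : pent_size 60.*2.
Proof.
by apply: split_pent_sizeW; apply: (@pent_step 15 15) => //; apply: base_pent.
Qed.

(** One value of [t] for each residue of [h] modulo 18, such that [h - t] is
    [9] or [15] modulo 18, that is, three times an odd number that is 0 or 2
    modulo 3; the entries at residues 1 modulo 3 are placeholders. *)
Definition increments : seq nat :=
  [:: 39; 0; 95; 60; 0; 86; 15; 0; 89; 0; 0; 86; 15; 0; 89; 0; 0; 98].

Lemma split_pent_large h : 1418 <= h -> h %% 3 != 1 -> split_pent_size h.*2.
Proof.
elim/ltn_ind: h => h IH h_ge h3.
have [h_lt|h_big] := ltnP h (1418 + 2934).
  by apply: split_pent_middle; rewrite ?h_ge.
suff [t [pt t_le res]] : exists t, [/\ pent_size t.*2, t <= 98 &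
    (h %% 18 == (t + 9) %% 18) || (h %% 18 == (t + 15) %% 18)].
  pose n := (h - t) %/ 3.
  have hE : h = 3 * n + t by rewrite /n; lia.
  rewrite hE; apply: pent_step => //; [lia | lia | ].
  by apply/split_pent_sizeW/IH; lia.
have : all (fun r => (r %% 3 == 1) || let t := nth 0 increments r in
    [&& t \in [:: 0, 60 & base_sizes], t <= 98 &
        (r == (t + 9) %% 18) || (r == (t + 15) %% 18)]) (iota 0 18) by [].
move=> /allP/(_ (h %% 18)); rewrite mem_iota ltn_mod => /(_ isT) /orP[|].
  by rewrite modn_dvdm // (negbTE h3).
case/and3P; set t := nth _ _ _; rewrite !in_cons => pt t_le res.
exists t; split=> //; case/or3P: pt => [/eqP->|/eqP->|/base_pent //].
  exact: pent_size0.
exact: pent60.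
Qed.

Theorem theorem4p1 (r : nat) :
  1413 <= r ->
  r = 0 %[mod 3] \/ r = 1 %[mod 3] ->
  exists (T : finType) (lines : {set {set T}}),
    [/\ PENT lines 3 r 9,
        type_D lines 3 9 &
        forall C : {set T}, C \in components (deficiency lines) ->
          has_girth (deficiency lines) C 4].
Proof.
move=> r_ge r3; apply: split_pent_geometry; apply: split_pent_large; first lia.
by case: r3; lia.
Qed.
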